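(* Let $S$ be a subsemigroup of $\mathbf{I}\mathbb{N}_{\infty}$ which contains $\mathscr{C}_{\mathbb{N}}$, and let $S^{\boldsymbol{0}}$ be $S$ with an adjoined zero $\boldsymbol{0}$. Then every Hausdorff locally compact shift-continuous topology $\tau$ on the semigroup $S^{\boldsymbol{0}}$ is either compact or discrete.
   Context: $\mathbb{N}=\{1,2,3,\ldots\}$. Partial maps are written on the right of their arguments and composed from left to right: $(x)(\gamma\delta)=((x)\gamma)\delta$. $\mathbf{I}\mathbb{N}_{\infty}$ is the monoid, under composition of partial maps, of all partial isometries $\gamma\colon\mathbb{N}\rightharpoonup\mathbb{N}$ (i.e. $|(x)\gamma-(y)\gamma|=|x-y|$ for all $x,y\in\operatorname{dom}\gamma$) such that $\mathbb{N}\setminus\operatorname{dom}\gamma$ and $\mathbb{N}\setminus\operatorname{ran}\gamma$ are finite. $\mathscr{C}_{\mathbb{N}}$ is the submonoid of $\mathbf{I}\mathbb{N}_{\infty}$ generated by $\alpha\colon\mathbb{N}\to\mathbb{N}\setminus\{1\}$, $(n)\alpha=n+1$, and $\beta\colon\mathbb{N}\setminus\{1\}\to\mathbb{N}$, $(n)\beta=n-1$ (it is isomorphic to the bicyclic monoid). $S^{\boldsymbol{0}}=S\sqcup\{\boldsymbol{0}\}$ with $\boldsymbol{0}\cdot x=x\cdot\boldsymbol{0}=\boldsymbol{0}$ for all $x\in S^{\boldsymbol{0}}$. A topology on a semigroup is shift-continuous if the semigroup operation is separately continuous. A space is locally compact if every point has an open neighbourhood with compact closure. *)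

(* Defs.v *)
From HB Require Import structures.
From mathcomp Require Import all_boot all_order all_algebra.
From mathcomp Require Import all_classical topology.

Set Implicit Arguments.
Unset Strict Implicit.
Unset Printing Implicit Defensive.

Local Open Scope classical_set_scope.
Local Open Scope group_scope.

Definition posnat : Type := {n : nat | (0 < n)%N}.
HB.instance Definition _ := SubChoice.on posnat.

(* [posn n] is the positive integer n + 1. *)
Definition posn (n : nat) : posnat := exist _ n.+1 (ltn0Sn n).

(* Partial maps act on the right: [partial_comp f g] is first f, then g. *)
Definition partial_map : Type := posnat -> option posnat.
HB.instance Definition _ := Choice.on partial_map.

Definition partial_id : partial_map := fun x => Some x.
Definition partial_comp (f g : partial_map) : partial_map := fun x => obind g (f x).

Definition pdom (f : partial_map) : set posnat :=
  [set x | exists y, f x = Some y].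
Definition pran (f : partial_map) : set posnat :=
  [set y | exists x, f x = Some y].

Definition partial_isometry (f : partial_map) : Prop :=
  forall x y x' y', f x = Some x' -> f y = Some y' ->
    `|val x' - val y'|%N = `|val x - val y|%N.

Definition cofinite_isometry (f : partial_map) : Prop :=
  [/\ partial_isometry f, finite_set (~` pdom f) & finite_set (~` pran f)].

Record IN_infty : Type := MkIN {
  IN_map :> partial_map;
  IN_prop : cofinite_isometry IN_map
}.

HB.instance Definition _ := gen_eqMixin IN_infty.
HB.instance Definition _ := gen_choiceMixin IN_infty.

Lemma IN_inj (f g : IN_infty) : IN_map f =1 IN_map g -> f = g.
Proof.
case: f g => [f pf] [g pg] /= /funext fg; rewrite -fg in pg *.
by congr MkIN; exact: Prop_irrelevance.
Qed.

Lemma partial_isometry_inj (f : partial_map) x y z : partial_isometry f ->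
  f x = Some z -> f y = Some z -> x = y.
Proof.
move=> fI fx fy; have := fI _ _ _ _ fx fy; rewrite distnn => /esym/eqP.
by rewrite distn_eq0 => /eqP/val_inj.
Qed.

Lemma cofinite_isometry_id : cofinite_isometry partial_id.
Proof.
split=> [x y _ _ [<-] [<-] //||].
- by rewrite (_ : ~` _ = set0) // -subset0 => x; apply; exists x.
- by rewrite (_ : ~` _ = set0) // -subset0 => x; apply; exists x.
Qed.

Lemma cofinite_isometry_comp (f g : partial_map) :
  cofinite_isometry f -> cofinite_isometry g ->
  cofinite_isometry (partial_comp f g).
Proof.
move=> [fI fd fr] [gI gd gr]; split.
- move=> x y x' y'; rewrite /partial_comp.
  case fx: (f x) => [u|//]; case fy: (f y) => [v|//] /= gu gv.
  by rewrite (gI _ _ _ _ gu gv) (fI _ _ _ _ fx fy).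
- pose pre (y : posnat) := xget (posn 0) [set x | f x = Some y].
  apply: (@sub_finite_set _ _ (~` pdom f `|` pre @` (~` pdom g))); last first.
    by rewrite finite_setU; split=> //; exact: finite_image.
  move=> x nx; case fx: (f x) => [y|]; last by left=> -[y]; rewrite fx.
  right; exists y.
    by move=> [z gz]; apply: nx; exists z; rewrite /partial_comp fx.
  rewrite /pre; case: xgetP => [x' _ fx'|/(_ x)//].
  exact: (partial_isometry_inj fI fx' fx).
- pose im (y : posnat) := odflt (posn 0) (g y).
  apply: (@sub_finite_set _ _ (~` pran g `|` im @` (~` pran f))); last first.
    by rewrite finite_setU; split=> //; exact: finite_image.
  move=> z nz; have [[y gy]|ng] := pselect (pran g z); last by left.
  right; exists y; last by rewrite /im gy.
  by move=> [x fx]; apply: nz; exists x; rewrite /partial_comp fx.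
Qed.

Definition IN_one : IN_infty := MkIN cofinite_isometry_id.
Definition IN_mul (f g : IN_infty) : IN_infty :=
  MkIN (cofinite_isometry_comp (IN_prop f) (IN_prop g)).

Lemma IN_mulA : associative IN_mul.
Proof.
by move=> f g h; apply: IN_inj => x /=; rewrite /partial_comp; case: (IN_map f x).
Qed.

Lemma IN_1mul : left_id IN_one IN_mul.
Proof. by move=> f; apply: IN_inj. Qed.

Lemma IN_mul1 : right_id IN_one IN_mul.
Proof.
by move=> f; apply: IN_inj => x /=; rewrite /partial_comp; case: (IN_map f x).
Qed.

HB.instance Definition _ := isMonoid.Build IN_infty IN_mulA IN_1mul IN_mul1.

Definition alpha_map : partial_map := fun x => Some (posn (val x)).
(* At n = 1 the insertion of n - 1 = 0 into [posnat] fails. *)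
Definition beta_map : partial_map := fun x => insub (val x).-1.

Lemma beta_mapE (x y : posnat) : (beta_map x = Some y) <-> val x = (val y).+1.
Proof.
rewrite /beta_map; split.
  case: insubP => // u u0 ux [<-]; rewrite ux prednK //.
  exact: (valP x).
by move=> -> /=; rewrite valK.
Qed.

Lemma pos_surj (y : posnat) : exists n, y = posn n.
Proof. by exists (val y).-1; apply: val_inj; rewrite /= prednK// (valP y). Qed.

Lemma finite_compl (A : set posnat) :
  (forall n, A (posn n.+1)) -> finite_set (~` A).
Proof.
move=> AS; apply: (@sub_finite_set _ _ [set posn 0]); last exact: finite_set1.
by move=> x; have [[|n] ->] := pos_surj x => // /(_ (AS n)).
Qed.

Lemma alpha_subproof : cofinite_isometry alpha_map.
Proof.
split.
- by move=> x y _ _ [<-] [<-] /=;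
  rewrite -(addn1 (sval x)) -(addn1 (sval y)) distnDr.
- by apply: finite_compl => n; exists (posn n.+2).
- by apply: finite_compl => n; exists (posn n).
Qed.

Lemma beta_subproof : cofinite_isometry beta_map.
Proof.
split.
- move=> x y x' y' /beta_mapE-> /beta_mapE->.
  by rewrite -(addn1 (val x')) -(addn1 (val y')) distnDr.
- by apply: finite_compl => n; exists (posn n); apply/beta_mapE.
- by apply: finite_compl => n; exists (posn n.+2); apply/beta_mapE.
Qed.

Definition alpha : IN_infty := MkIN alpha_subproof.
Definition beta : IN_infty := MkIN beta_subproof.

Definition submonoid_generated (M : monoidType) (G : set M) : set M :=
  smallest [set A : set M | monoid_closed [in A]] G.

Definition C_N : set IN_infty := submonoid_generated [set alpha; beta].

Definition subsemigroup (G : semigroupType) (S : mulgClosed G) : Type :=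
  {x : G | x \in S}.
HB.instance Definition _ (G : semigroupType) (S : mulgClosed G) :=
  SubChoice.on (subsemigroup S).
HB.instance Definition _ (G : semigroupType) (S : mulgClosed G) :=
  SubChoice_isSubSemigroup.Build G (fun x => x \in S) (subsemigroup S) (@gpredM G S).

(* The adjoined zero is [None]. *)
Definition with_zero (G : semigroupType) : Type := option G.
HB.instance Definition _ (G : semigroupType) := Choice.on (with_zero G).

Definition with_zero_mul (G : semigroupType) (x y : with_zero G) : with_zero G :=
  match x, y with
  | Some a, Some b => Some (a * b)
  | _, _ => None
  end.

Lemma with_zero_mulA (G : semigroupType) : associative (@with_zero_mul G).
Proof. by move=> [x|] [y|] [z|] //=; rewrite mulgA. Qed.

HB.instance Definition _ (G : semigroupType) :=
  isSemigroup.Build (with_zero G) (@with_zero_mulA G).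

Record topology_on (X : Type) : Type := TopologyOn {
  tau_open : set_system X;
  tau_openT : tau_open setT;
  tau_openI : setI_closed tau_open;
  tau_open_bigU : forall (I : Type) (f : I -> set X),
    (forall i, tau_open (f i)) -> tau_open (\bigcup_i f i)
}.

(* The set X endowed with the topology tau. *)
Definition topologized (X : choiceType) (tau : topology_on X) : Type := X.
HB.instance Definition _ (X : choiceType) (tau : topology_on X) :=
  Choice.on (topologized tau).
HB.instance Definition _ (X : choiceType) (tau : topology_on X) :=
  isOpenTopological.Build (topologized tau)
    (@tau_openT X tau) (@tau_openI X tau) (@tau_open_bigU X tau).

Lemma topologized_openE (X : choiceType) (tau : topology_on X) (A : set X) :
  open (A : set (topologized tau)) = tau_open tau A.
Proof. by []. Qed.

Lemma locally_compactE (T : topologicalType) :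
  locally_compact [set: T] <->
  forall x : T, exists U : set T, open_nbhs x U /\ compact (closure U).
Proof.
split=> [lc x|h x _].
  have [U nU [cU clU]] := lc x I; exists U^°; split; last first.
    apply: (subclosed_compact _ cU); first exact: closed_closure.
    rewrite [X in _ `<=` X](iffLR (closure_id U) clU).
    by apply: closureS; exact: interior_subset.
  split; [exact: open_interior | apply: (@filterS _ (nbhs x) _ _ U _ nU)].
  by move=> y; apply.
have [U [Ux cU]] := h x; exists (closure U).
  apply: (@filterS _ (nbhs x) _ U _ _ (open_nbhs_nbhs Ux)) => y Uy _.
  exact: subset_closure.
by split=> //; exact: closed_closure.
Qed.

Definition discrete_space (T : topologicalType) : Prop :=
  forall A : set T, open A.

Definition shift_continuous (G : semigroupType) (tau : topology_on G) : Prop :=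
  forall a : G,
    continuous ((fun x => a * x) : topologized tau -> topologized tau) /\
    continuous ((fun x => x * a) : topologized tau -> topologized tau).

(* Main.v *)
(* Nonzero points are isolated: [S] is countable, so by Baire some nonzero [x]
   is isolated, and each [{z | a z b = c}] is finite, so that isolation spreads
   from [x] to [1] (through [x z = x]) and from [1] to every [z] (through
   [alpha^i z beta^j = 1]).  If zero is not isolated, let [K] be a compact
   neighbourhood of it.  [K] minus any neighbourhood of zero is finite, so each
   translation maps almost all of [K] into [K]; hence only finitely many edges
   [z -- beta z] and [z -- z alpha] leave [K].  Outside the finite set of those
   [z] whose grid [beta^i z alpha^j] meets such an edge, membership in [K] is
   constant along the grid.  As [K] is infinite, it contains all [z0 alpha^n]
   for some [z0]; since [alpha^i z0 = alpha^j], it contains almost all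
   [alpha^n], hence for every [z] almost all [z alpha^n], so that the
   complement of [K] lies in the finite exceptional set. *)
Require Import Defs.
From mathcomp Require Import all_boot all_order all_algebra finmap zify.
From mathcomp Require Import all_classical topology.

Local Open Scope classical_set_scope.


Lemma finite_set_bounded (T : eqType) (A : set T) (f : T -> nat) :
  finite_set A -> exists N, forall x, A x -> (f x <= N)%N.
Proof.
case/finite_seqP=> s ->; exists (\max_(x <- s) f x)%N => x xs.
exact: leq_bigmax_seq.
Qed.

Lemma finite_set_seq_avoid (T : Type) (A : set T) (f : nat -> T) :
  injective f -> finite_set A -> exists N, forall n, (N <= n)%N -> ~ A (f n).
Proof.
move=> fI Afin.
have /(@finite_set_bounded nat _ id)[N AN] : finite_set (f @^-1` A).
  by apply: finite_preimage => // x y _ _; exact: fI.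
by exists N.+1 => n Nn /AN; rewrite leqNgt Nn.
Qed.

(** * Cofinite partial isometries as restricted translations *)

Section IN_infty_monoid.
Local Open Scope group_scope.

Lemma mulINE (f g : IN_infty) x : IN_map (f * g) x = obind (IN_map g) (IN_map f x).
Proof. by []. Qed.

Lemma IN_cofinal (z : IN_infty) N :
  exists2 m, (N < val m)%N & exists y, IN_map z m = Some y.
Proof.
have [_ + _] := IN_prop z => /(@finite_set_bounded _ _ val)[M zM].
exists (posn (N + M)); first by rewrite /=; lia.
by apply: contrapT => /zM /=; lia.
Qed.

(** Distances alone would allow a reflection, but it would send a domain point [n] exceeding the sum
    of the four values below zero. *)
Lemma IN_translation {z : IN_infty} {m m' y y'} :
  IN_map z m = Some y -> IN_map z m' = Some y' ->
  (val y + val m' = val y' + val m)%N.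
Proof.
move=> zm zm'; have [zI _ _] := IN_prop z.
have [n nlt [w zn]] := IN_cofinal z (val m + val m' + val y + val y').
have := zI _ _ _ _ zn zm; have := zI _ _ _ _ zn zm'.
move: (val n) (val m) (val m') (val y) (val y') (val w) nlt; lia.
Qed.

(** An element is a translation restricted to its domain, so one value fixes it there. *)
Lemma IN_eq (z z' : IN_infty) m : pdom z = pdom z' -> pdom z m ->
  IN_map z m = IN_map z' m -> z = z'.
Proof.
move=> dom [y zm] z'm; apply: IN_inj => x.
have domx : pdom z x <-> pdom z' x by rewrite dom.
case zx: (IN_map z x) => [u|]; case z'x: (IN_map z' x) => [v|] //.
- congr Some; apply: val_inj.
  have := IN_translation zx zm; have := IN_translation z'x (etrans (esym z'm) zm).
  rewrite /=; lia.
- have [[v]] : pdom z' x by apply/domx; exists u.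
  by rewrite z'x.
- have [[u]] : pdom z x by apply/domx; exists v.
  by rewrite zx.
Qed.

Lemma countable_IN_infty : countable [set: IN_infty].
Proof.
have /choice[h hP] : forall z : IN_infty,
    exists p : posnat * posnat, IN_map z p.1 = Some p.2.
  by move=> z; have [m _ [y zm]] := IN_cofinal z 0; exists (m, y).
have codom_fin (z : IN_infty) : finite_set (val @` (~` pdom z) : set nat).
  by apply: finite_image; have [_ + _] := IN_prop z.
(* The code of [z] is its finite set of gaps in the domain together with one point of its graph. *)
apply/countable_injP; exists (fun z : IN_infty => choice.pickle
  (fset_set (val @` (~` pdom z) : set nat), (val (h z).1, val (h z).2))).
move=> z z' _ _ /(pcan_inj choice.pickleK)[dom /val_inj h1 /val_inj h2].
apply: (@IN_eq _ _ (h z).1); last by rewrite hP h1 h2 hP.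
- have {dom}/seteqP[sub sup] := fset_set_inj (codom_fin z) (codom_fin z') dom.
  apply: setC_inj; apply/seteqP; split=> x xN.
    by have [|u uN /val_inj<-//] := sub (val x); exists x.
  by have [|u uN /val_inj<-//] := sup (val x); exists x.
- by exists (h z).2.
Qed.

(** On the cofinite set [M] every solution agrees with [z0], because [b] is injective. Hence a
    solution is determined by the complement of its domain, a subset of the finite complement of
    [M]. *)
Lemma finite_set_solutions (a b z0 : IN_infty) :
  finite_set [set z : IN_infty | a * z * b = a * z0 * b].
Proof.
pose M := pran a `&` pdom (IN_map (z0 * b)).
have Mfin : finite_set (~` M).
  rewrite setCI finite_setU; split; first by have [] := IN_prop a.
  by have [] := IN_prop (z0 * b).
have zM (z : IN_infty) m : a * z * b = a * z0 * b -> M m ->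
    exists2 y, IN_map z m = Some y & IN_map z0 m = Some y.
  move=> eqz [[n an] [w]]; rewrite mulINE.
  case z0m: (IN_map z0 m) => [y|//] /= byw.
  have := congr1 (fun f : IN_infty => IN_map f n) eqz.
  rewrite !mulINE an /= z0m /= byw.
  case: (IN_map z m) => [y'|//] /= by'w; exists y' => //; congr Some.
  by have [bI _ _] := IN_prop b; exact: partial_isometry_inj bI byw by'w.
(* Decodes a solution from its gaps; the default [1] is harmless, since only sets coming from a
   solution matter. *)
pose h (X : {fset posnat}) : IN_infty :=
  xget 1 [set z | a * z * b = a * z0 * b /\ ~` pdom z = [set` X]].
have [m Mm] : exists m, M m.
  have [N NM] := @finite_set_bounded _ _ val Mfin.
  by exists (posn N); apply: contrapT => /NM /=; rewrite ltnn.
apply: (@sub_finite_set _ _ (h @` [set` fpowerset (fset_set (~` M))])); last first.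
  exact: finite_image.
move=> z eqz; have zfin : finite_set (~` pdom z) by have [] := IN_prop z.
exists (fset_set (~` pdom z)).
  rewrite /= fpowersetE; apply/fsubsetP => x; rewrite !in_fset_set // !inE.
  by apply: contra_not => /(zM _ _ eqz)[y]; exists y.
rewrite /h; case: xgetP => [z' -> [eqz' dom']|/(_ z)]; last first.
  by case; split=> //; rewrite fset_setK.
have [y zm z0m] := zM _ _ eqz Mm; have [y' z'm z0m'] := zM _ _ eqz' Mm.
apply: (@IN_eq _ _ m); first by apply: setC_inj; rewrite dom' fset_setK.
  by exists y'.
by rewrite z'm zm -z0m -z0m'.
Qed.

Lemma alphaK : alpha * beta = 1.
Proof. by apply: IN_inj => x /=; apply/beta_mapE. Qed.

Lemma alphaXK n : alpha ^+ n * beta ^+ n = 1.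
Proof.
elim: n => [|n IHn]; first by rewrite !expg0 mulg1.
by rewrite expgS expgSr mulgA -(mulgA alpha) IHn mulg1 alphaK.
Qed.

Lemma alphaX n x y : IN_map (alpha ^+ n) x = Some y <-> val y = (val x + n)%N.
Proof.
elim: n y => [|n IHn] y.
  rewrite expg0 addn0; split=> [[->] //|/val_inj->//].
rewrite expgSr mulINE addnS; split.
  by case E: (IN_map _ x) => [u|//] [<-] /=; move/IHn: E => <-.
have xn : (0 < val x + n)%N by rewrite addn_gt0 (valP x).
move=> yE; have /IHn-> : val (exist _ (val x + n)%N xn : posnat) = (val x + n)%N by [].
by congr Some; apply: val_inj.
Qed.

Lemma betaX n x y : IN_map (beta ^+ n) x = Some y <-> val x = (val y + n)%N.
Proof.
elim: n y => [|n IHn] y.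
  rewrite expg0 addn0; split=> [[->] //|/val_inj->//].
rewrite expgSr mulINE addnS; split.
  case E: (IN_map _ x) => [u|//] /= /beta_mapE uE.
  by move/IHn: E => ->; rewrite uE addSn.
have yn : (0 < (val y).+1)%N by [].
move=> xE; have /IHn-> : val x = (val (exist _ (val y).+1 yn : posnat) + n)%N.
  by rewrite xE /= addSn.
exact/beta_mapE.
Qed.

Lemma alphaX_absorb (z : IN_infty) : exists i j, alpha ^+ i * z = alpha ^+ j.
Proof.
have [m0 _ [y0 zm0]] := IN_cofinal z 0.
have [_ + _] := IN_prop z => /(@finite_set_bounded _ _ val)[M zM].
(* [M] bounds the gaps in the domain of [z]; a shift by [M + val m0] jumps past them, and [z] then
   adds [val y0 - val m0]. *)
exists (M + val m0)%N, (M + val y0)%N; apply: IN_inj => x.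
have xi : (0 < val x + (M + val m0))%N by rewrite addn_gt0 (valP x).
pose m : posnat := exist _ (val x + (M + val m0))%N xi.
have [y zm] : pdom z m.
  apply: contrapT => /zM; rewrite leqNgt => /negP; apply.
  by rewrite /= addnCA -[ltnLHS]addn0 ltn_add2l addn_gt0 (valP x).
rewrite mulINE (_ : IN_map (alpha ^+ (M + val m0)) x = Some m) /=; last exact/alphaX.
rewrite zm; apply/esym/alphaX.
by have := IN_translation zm zm0; rewrite /=; lia.
Qed.

Lemma mul_alphaX_inj (z : IN_infty) : injective (fun n => z * alpha ^+ n).
Proof.
move=> n n' /(congr1 (fun f : IN_infty => IN_map f)) eqz.
have [m _ [y zm]] := IN_cofinal z 0; have := congr1 (@^~ m) eqz.
rewrite !mulINE zm /=.
have yn : (0 < val y + n)%N by rewrite addn_gt0 (valP y).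
pose w : posnat := exist _ (val y + n)%N yn.
rewrite (_ : IN_map (alpha ^+ n) y = Some w); last exact/alphaX.
by move=> /esym/alphaX /= /addnI.
Qed.

(* [z = alpha ^+ i * w * beta ^+ j], where [i] and [j] are less than any element
   of the domain of [w] and its image, respectively. *)
Lemma finite_set_grid_pred (w : IN_infty) :
  finite_set [set z : IN_infty | exists i j, beta ^+ i * z * alpha ^+ j = w].
Proof.
have [m _ [y wm]] := IN_cofinal w 0.
apply: (@sub_finite_set _ _
  ((fun ij => alpha ^+ ij.1 * w * beta ^+ ij.2) @` (`I_(val m) `*` `I_(val y)))).
  move=> z [i [j zw]]; exists (i, j) => /=.
    move: wm; rewrite -zw !mulINE.
    case E: (IN_map (beta ^+ i) m) => [u|//] /=.
    case: (IN_map z u) => [v|//] /= /alphaX yE.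
    move/betaX: E => mE.
    split; [change (i < val m)%N; rewrite mE | change (j < val y)%N; rewrite yE].
      by rewrite -[ltnLHS]add0n ltn_add2r (valP u).
    by rewrite -[ltnLHS]add0n ltn_add2r (valP v).
  by rewrite -zw !mulgA alphaXK mul1g -mulgA alphaXK mulg1.
by apply: finite_image; apply: finite_setX; exact: finite_II.
Qed.

Lemma mulgClosed_expg (S : mulgClosed IN_infty) a n :
  1 \in S -> a \in S -> a ^+ n \in S.
Proof.
by move=> S1 Sa; elim: n => [|n IHn]; rewrite ?expg0 // expgS gpredM.
Qed.

End IN_infty_monoid.


(** * Cofiniteness of almost invariant sets *)

Section almost_invariant.
Local Open Scope group_scope.
Variables (S : mulgClosed IN_infty) (K : set IN_infty).
Hypotheses (Salpha : alpha \in S) (Sbeta : beta \in S) (KS : K `<=` [set` S]).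
Hypothesis Kl : forall a, a \in S -> finite_set [set z | K z /\ ~ K (a * z)].
Hypothesis Kr : forall a, a \in S -> finite_set [set z | K z /\ ~ K (z * a)].

Let S1 : 1 \in S.
Proof. by rewrite -alphaK gpredM. Qed.

Let SX a n : a \in S -> a ^+ n \in S.
Proof. exact: mulgClosed_expg. Qed.

Let boundary :=
  [set z | z \in S /\ ~ ((K z <-> K (beta * z)) /\ (K z <-> K (z * alpha)))].

(* Since [alpha * (beta * z) = z] and [z * alpha * beta = z], a step leaving
   the complement of [K] is a reversed step leaving [K]. *)
Let finite_boundary : finite_set boundary.
Proof.
have lfin := Kl _ Sbeta; have rfin := Kr _ Salpha.
have lfin' := finite_image (fun z => alpha * z) (Kl _ Salpha).
have rfin' := finite_image (fun z => z * beta) (Kr _ Sbeta).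
have UB : finite_set (([set z | K z /\ ~ K (beta * z)] `|`
    [set z | K z /\ ~ K (z * alpha)]) `|`
    ((fun z => alpha * z) @` [set z | K z /\ ~ K (alpha * z)] `|`
     (fun z => z * beta) @` [set z | K z /\ ~ K (z * beta)])).
  by rewrite !finite_setU.
apply: sub_finite_set UB => z [Sz /not_andP[|] nK].
- have [Kz|nKz] := pselect (K z).
    by left; left; split=> // Kbz; apply: nK.
  have [Kbz|nKbz] := pselect (K (beta * z)); last by case: nK.
  by right; left; exists (beta * z); rewrite /= mulgA alphaK mul1g.
- have [Kz|nKz] := pselect (K z).
    by left; right; split=> // Kbz; apply: nK.
  have [Kbz|nKbz] := pselect (K (z * alpha)); last by case: nK.
  by right; right; exists (z * alpha); rewrite /= -mulgA alphaK mulg1.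
Qed.

Let irregular :=
  [set z | exists i j, boundary (beta ^+ i * z * alpha ^+ j)].

Let finite_irregular : finite_set irregular.
Proof.
suff -> : irregular = \bigcup_(w in boundary)
    [set z | exists i j, beta ^+ i * z * alpha ^+ j = w].
  by apply: bigcup_finite => // w _; exact: finite_set_grid_pred.
apply/seteqP; split=> [z [i [j zij]]|z [w wb [i [j zw]]]].
  by exists (beta ^+ i * z * alpha ^+ j) => //; exists i, j.
by exists i, j; rewrite zw.
Qed.

(** The row is the part of the grid with left factor [beta ^+ 0], and the grid of a regular [z] has
    no boundary element. *)
Let regular_row z n : z \in S -> ~ irregular z -> (K (z * alpha ^+ n) <-> K z).
Proof.
move=> Sz zreg; elim: n => [|n IHn]; first by rewrite expg0 mulg1.
rewrite expgSr mulgA -[X in _ <-> X]IHn.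
have : ~ boundary (z * alpha ^+ n).
  by move=> zb; apply: zreg; exists 0, n; rewrite expg0 mul1g.
move=> /not_andP[|/contrapT[_ ->]//].
by rewrite gpredM // SX.
Qed.

Lemma almost_invariant_cofinite : infinite_set K -> finite_set ([set` S] `\` K).
Proof.
move=> Kinf.
have [z0 [Kz0 z0reg]] : exists z, K z /\ ~ irregular z.
  apply: contrapT => noreg; apply: Kinf; apply: sub_finite_set finite_irregular.
  by move=> z Kz; apply: contrapT => zreg; apply: noreg; exists z.
have Kz0X n : K (z0 * alpha ^+ n) by apply/regular_row => //; exact: KS.
(* Left multiplication by [alpha ^+ i] turns [z0 * alpha ^+ n] into [alpha ^+ (j + n)], and this
   leaves [K] for finitely many [n] only, the [z0 * alpha ^+ n] being distinct. *)
have [N KalphaX] : exists N, forall n, (N <= n)%N -> K (alpha ^+ n).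
  have [i [j ij]] := alphaX_absorb z0.
  have [N NK] := finite_set_seq_avoid _ _ _ (mul_alphaX_inj z0)
    (Kl _ (SX _ i Salpha)).
  exists (j + N)%N => n jNn; have jn : (j <= n)%N by lia.
  rewrite -(subnKC jn) expgnDr -ij -mulgA; apply: contrapT => nK.
  by apply: (NK (n - j)%N); [lia | split].
apply: sub_finite_set finite_irregular => z [Sz nKz]; apply: contrapT => zreg.
(* Left multiplication by [z] keeps almost all [alpha ^+ n] in [K]; regularity then pulls membership
   back to [z]. *)
have [M MK] := finite_set_seq_avoid _ _ _ (mul_alphaX_inj 1) (Kl _ Sz).
apply: nKz; apply/(regular_row _ (N + M)%N Sz zreg); apply: contrapT => nK.
apply: (MK (N + M)%N); rewrite ?leq_addl // mul1g; split=> //.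
by apply: KalphaX; lia.
Qed.

End almost_invariant.


(** * Isolated points and compactness in Hausdorff spaces *)

Section topology_lemmas.
Variable T : topologicalType.
Hypothesis hT : hausdorff_space T.

Lemma hausdorff_finite_closed (A : set T) : finite_set A -> closed A.
Proof. by move=> /finite_compact; exact: compact_closed. Qed.

Lemma finite_open_set1 (A : set T) x :
  finite_set A -> open A -> A x -> open [set x].
Proof.
move=> Afin Aop Ax; rewrite (_ : [set x] = A `&` ~` (A `\ x)).
  apply: openI => //; apply: closed_openC.
  by apply: hausdorff_finite_closed; exact: finite_setD.
apply/seteqP; split=> [_ ->|y [Ay]]; first by split=> //= -[].
by move=> nAy; apply: contrapT => yx; exact: nAy (conj Ay yx).
Qed.

(** If the difference were infinite, its cofinite subsets would give a filter clustering at some [q]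
    in [K]. But [q = p] is excluded by [U], and any other [q] is isolated with its complement in the
    filter. *)
Lemma compact_setD_nbhs_finite (K U : set T) (p : T) :
  compact K -> (forall x, x <> p -> open [set x]) -> nbhs p U ->
  finite_set (K `\` U).
Proof.
move=> Kco iso Up; apply: contrapT => inf.
pose F : set_system T := [set A | finite_set ((K `\` U) `\` A)].
have FF : ProperFilter F.
  split; first by rewrite /F /= setD0.
  split; first by rewrite /F /= setDT.
  - by move=> A B FA FB; rewrite /F /mkset setDIr finite_setU.
  - by move=> A B AB; apply: sub_finite_set; exact: setDS.
have FK : F K by rewrite /F /= (_ : _ `\` K = set0) // -subset0 => x [[]].
have [q [_ clq]] := Kco F FF FK.
have Fset1 x : F (~` [set x]).
  by rewrite /F /= setDE setCK; exact/finite_setIr/finite_set1.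
have [qp|qp] := pselect (q = p).
  have FU : F (~` U).
    by rewrite /F /= (_ : _ `\` _ = set0) // -subset0 => x [[]].
  have [x [nUx Ux]] : ~` U `&` U !=set0 by apply: clq => //; rewrite qp.
  exact: nUx.
have [|x [nx]] := clq _ [set q] (Fset1 q); last exact: nx.
by apply: open_nbhs_nbhs; split=> //; exact: iso.
Qed.

(* Baire category argument. *)
Lemma countable_locally_compact_isolated (U : set T) :
  locally_compact [set: T] -> countable [set: T] -> open U -> U !=set0 ->
  exists2 x, U x & open [set x].
Proof.
move=> lc /countable_injP[f fI] Uop U0; apply: contrapT => noiso.
pose good (V : set T) := [/\ open V, V !=set0 & V `<=` U].
(* One Baire step: shrink [V] so that even the closure avoids the point numbered [n]. For a [V] that
   is not [good] any [W] will do. *)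
have /choice[F FP] : forall nV : nat * set T, exists W, good nV.2 ->
    [/\ good W, compact (closure W), W `<=` nV.2 &
      forall x, closure W x -> f x <> nV.1].
  move=> [n V] /=; have [[Vop [v Vv] VU]|] := pselect (good V); last by exists V.
  pose V' := V `&` [set x | f x <> n].
  have V'op : open V'.
    have [[x fx]|nx] := pselect (exists x, f x = n); last first.
      rewrite (_ : V' = V) //; apply/seteqP; split=> [x []//|x Vx].
      by split=> // fx; apply: nx; exists x.
    rewrite (_ : V' = V `&` ~` [set x]).
      apply: openI => //; apply: closed_openC.
      by apply: hausdorff_finite_closed; exact: finite_set1.
    apply/seteqP; split=> y [Vy yn]; split=> //.
      by move=> /= yx; move: yn; rewrite /= yx; apply.
    by move=> fy; case: yn; apply: fI; rewrite ?inE // fx fy.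
  (* Were [V'] empty, all points of [V] would have number [n], so [V] would be a single isolated
     point. *)
  have [y V'y] : V' !=set0.
    apply: contrapT => V'0; apply: noiso; exists v; first exact: VU.
    rewrite (_ : [set v] = V) //; apply/seteqP; split=> [_ ->//|x Vx].
    have fn w : V w -> f w = n.
      by move=> Vw; apply: contrapT => wn; apply: V'0; exists w.
    by apply: fI; rewrite ?inE // !fn.
  have [C [yC Cco]] := (locally_compactE _).1 lc y.
  have Cclo : compact (closure C) := Cco.
  have [||D yD DV'] := @compact_regular T y (closure C) hT Cclo _ V' _.
  - by apply: filterS (open_nbhs_nbhs yC); exact: subset_closure.
  - exact: open_nbhs_nbhs.
  have DCy : nbhs y (D `&` C) by apply: filterI => //; exact: open_nbhs_nbhs.
  pose W := interior (D `&` C).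
  have WDC : W `<=` D `&` C by exact: interior_subset.
  have clWV' : closure W `<=` V'.
    by apply: subset_trans DV'; apply: closureS => x /WDC[].
  have WV : W `<=` V by move=> x /subset_closure /clWV'[].
  exists W => _; split=> //.
  - split; [exact: open_interior | by exists y | exact: subset_trans VU].
  - apply: (subclosed_compact _ Cclo); first exact: closed_closure.
    by apply: closureS => x /WDC[].
  - by move=> x /clWV'[].
pose V := fix V n := if n is m.+1 then F (m, V m) else U.
have Vgood n : good (V n).
  by elim: n => [|n IHn]; [split | have [] := FP (n, V n) IHn].
have Vdecr n m : (n <= m)%N -> V m `<=` V n.
  move=> /subnK <-; elim: (m - n)%N => [|k IHk] //.
  by apply: subset_trans IHk; have [] := FP ((k + n)%N, V (k + n)%N) (Vgood _).
pose G : set_system T := [set A | exists n, V n `<=` A].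
have GG : ProperFilter G.
  split; first by move=> [n Vn0]; have [_ [x /Vn0]] := Vgood n.
  split; first by exists 0.
  - move=> A B [n VA] [m VB]; exists (maxn n m) => x Vx; split.
      by apply: VA; apply: Vdecr Vx; exact: leq_maxl.
    by apply: VB; apply: Vdecr Vx; exact: leq_maxr.
  - by move=> A B AB [n VA]; exists n; exact: subset_trans AB.
have [_ Vco _ _] := FP (0, U) (Vgood 0).
have [|p [_ clp]] := Vco G GG.
  by exists 1; exact: subset_closure.
(* The cluster point [p] lies in the closure of [V (f p).+1], which was chosen to avoid the number
   [f p]. *)
have [_ _ _] := FP (f p, V (f p)) (Vgood _); apply; last reflexivity.
move=> B Bp; apply: clp => //; exists (f p).+1 => //.
Qed.

End topology_lemmas.


(** * The topology on [S] with adjoined zero *)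

Section adjoined_zero.
Local Open Scope group_scope.
Variables (S : mulgClosed IN_infty) (tau : topology_on (with_zero (subsemigroup S))).
Hypotheses (Salpha : alpha \in S) (Sbeta : beta \in S).
Hypothesis hT : hausdorff_space (topologized tau).
Hypothesis lcT : locally_compact [set: topologized tau].
Hypothesis scT : shift_continuous tau.

Let T := topologized tau.
Let zero : T := None.
Let emb (x : IN_infty) (Sx : x \in S) : T := Some (exist _ x Sx).
Let proj (t : T) : IN_infty := if t is Some u then val u else 1.

Let nonzeroE (t : T) : t <> zero -> exists x (Sx : x \in S), t = emb x Sx.
Proof. by case: t => [[x Sx]|//] _; exists x, Sx. Qed.

Let embM x y (Sx : x \in S) (Sy : y \in S) :
  (emb x Sx : with_zero _) * emb y Sy = emb (x * y) (gpredM _ _ Sx Sy).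
Proof. by congr Some; apply: val_inj. Qed.

(** [proj] merges only zero with the identity, so its fibres have at most two points. *)
Let finite_proj (A : set T) : finite_set (proj @` A) -> finite_set A.
Proof.
move=> pA; apply: (@sub_finite_set _ _
  ([set zero] `|` (fun x => if insub x is Some u then Some u : T else zero)
     @` (proj @` A))).
  move=> [u|] At; [right|by left].
  by exists (val u); [exists (Some u)|rewrite valK].
by rewrite finite_setU; split; [exact: finite_set1|exact: finite_image].
Qed.

Let open_mull (a : T) (A : set T) :
  open A -> open [set t : T | A ((a : with_zero _) * t)].
Proof. by have [/continuousP + _] := scT a; apply. Qed.

Let open_mulr (a : T) (A : set T) :
  open A -> open [set t : T | A ((t : with_zero _) * a)].
Proof. by have [_ /continuousP +] := scT a; apply. Qed.

Let S1 : 1 \in S.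
Proof. by rewrite -alphaK gpredM. Qed.

Let SX a n : a \in S -> a ^+ n \in S.
Proof. exact: mulgClosed_expg. Qed.

(** The solutions [t] of [a * t * b = c] form an open set by separate continuity, and a finite one;
    in a Hausdorff space its points are isolated. *)
Let open_set1_solution a b z c (Sa : a \in S) (Sb : b \in S) (Sz : z \in S)
  (Sc : c \in S) : a * z * b = c -> open [set emb c Sc] -> open [set emb z Sz].
Proof.
move=> azb oc.
have := open_mull (emb a Sa) _ (open_mulr (emb b Sb) _ oc).
move=> /(finite_open_set1 _ hT _ (emb z Sz)); apply.
  apply: finite_proj; apply: sub_finite_set (finite_set_solutions a b z).
  by move=> _ [[[y Sy]|] //= [] yE <-] /=; rewrite azb.
by rewrite /= !embM; congr Some; apply: val_inj.
Qed.

Let open_set1_nonzero (t : T) : t <> zero -> open [set t].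
Proof.
have Tcount : countable [set: T].
  have /countable_injP[f fI] := countable_IN_infty.
  apply/countable_injP.
  exists (fun t : T => if t is Some u then (f (val u)).+1 else 0).
  move=> [u|] [u'|] _ _ //= [] /fI fuu'; congr Some; apply: val_inj.
  by apply: fuu'; rewrite inE.
have [||_ /= /nonzeroE[x [Sx ->]] ox] :=
    @countable_locally_compact_isolated T hT (~` [set zero]) lcT Tcount.
- by apply: closed_openC; apply: hausdorff_finite_closed => //; exact: finite_set1.
- by exists (emb 1 S1).
have o1 : open [set emb 1 S1].
  by apply: (open_set1_solution x 1) ox => //; rewrite !mulg1.
move=> /nonzeroE[z [Sz ->]]; have [i [j ij]] := alphaX_absorb z.
apply: (open_set1_solution (alpha ^+ i) (beta ^+ j)) o1; rewrite ?SX //.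
by rewrite ij alphaXK.
Qed.

Lemma compact_or_discrete : compact [set: T] \/ discrete_space T.
Proof.
have [o0|no0] := pselect (open [set zero]).
  right=> A; rewrite -(image_id A) -bigcup_imset1.
  apply: bigcup_open => t _.
  by have [->//|/open_set1_nonzero] := pselect (t = zero).
left; have [K0 [K00 Kco]] := (locally_compactE _).1 lcT zero.
pose K := closure K0.
have K0K : K0 `<=` K by exact: subset_closure.
have almost (U : set T) : open U -> U zero -> finite_set (K `\` U).
  move=> Uop U0; apply: (@compact_setD_nbhs_finite T K U zero) => //.
  by apply: open_nbhs_nbhs; split.
pose K' := [set z | exists Sz : z \in S, K (emb z Sz)].
have [K0op K0zero] := K00.
have K'fin : finite_set ([set` S] `\` K').
  apply: almost_invariant_cofinite => //.
  - by move=> z [].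
  (* Since zero absorbs, the preimage of [K0] under a translation is a neighbourhood of zero, hence
     misses only finitely many points of [K]. *)
  - move=> a Sa; have := almost _ (open_mull (emb a Sa) _ K0op) K0zero.
    move=> /(finite_image proj); apply: sub_finite_set => z [[Sz Kz] naz].
    exists (emb z Sz) => //; split=> // /K0K; rewrite embM => Kaz.
    by apply: naz; exists (gpredM _ _ Sa Sz).
  - move=> a Sa; have := almost _ (open_mulr (emb a Sa) _ K0op) K0zero.
    move=> /(finite_image proj); apply: sub_finite_set => z [[Sz Kz] nza].
    exists (emb z Sz) => //; split=> // /K0K; rewrite embM => Kza.
    by apply: nza; exists (gpredM _ _ Sz Sa).
  (* A finite [K'] would make the open set [K0] finite and so isolate zero. *)
  - move=> K'fin; apply: no0; apply: (@finite_open_set1 T hT K0) => //.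
    apply: (@sub_finite_set _ _ K) => //; apply: finite_proj.
    (* The extra [1] is the value of [proj] at zero. *)
    apply: (@sub_finite_set _ _ ([set 1] `|` K')).
      by move=> _ [[[z Sz]|] Kz <-]; [right; exists Sz|left].
    by rewrite finite_setU; split=> //; exact: finite_set1.
rewrite -(setUv K); apply: compactU => //; apply: finite_compact.
apply: finite_proj; apply: sub_finite_set K'fin => _ [[[z Sz]|] nKz <-] /=.
  by split=> // -[Sz']; rewrite (Prop_irrelevance Sz' Sz).
by case: nKz; exact: K0K.
Qed.

End adjoined_zero.

Theorem theorem3p12 (S : mulgClosed IN_infty) (CS : C_N `<=` [set` S])
  (tau : topology_on (with_zero (subsemigroup S))) :
  hausdorff_space (topologized tau) ->
  locally_compact [set: topologized tau] ->
  shift_continuous tau ->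
  compact [set: topologized tau] \/ discrete_space (topologized tau).
Proof.
(* [C_N] is the intersection of the submonoids containing [alpha] and [beta], so it contains
   both. *)
by apply: compact_or_discrete; apply: CS => A [_]; apply; [left|right].
Qed.
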